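(* There exists a break-free $\mathbb{N}$-quasi-barrycade of infinite height, that is, there exists an infinite sequence $(\mu_1,\mu_2,\mu_3,\ldots)$ of quasi-permutations such that $S_{\mu_i}\cap S_{\mu_j}=\emptyset$ for all $i\neq j$ and $\bigcup_{i\geq 1}S_{\mu_i}=\mathbb{N}$.
   Context: $\mathbb{N}$ denotes the set of positive integers. A quasi-permutation is an infinite sequence $\mu=(a_1,a_2,a_3,\ldots)$ of positive integers with $a_i\neq a_j$ for $i\neq j$. Its set of partial sums is $S_\mu=\{a_1,\ a_1+a_2,\ a_1+a_2+a_3,\ \ldots\}$. An $\mathbb{N}$-quasi-barrycade (of infinite height) is an infinite collection $(\mu_1,\mu_2,\mu_3,\ldots)$ of quasi-permutations such that $S_{\mu_i}\cap S_{\mu_j}=\emptyset$ for all $i\neq j$. It is break-free if every positive integer is a partial sum of one of its rows, i.e. $\bigcup_{i\geq 1}S_{\mu_i}=\mathbb{N}$. *)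

(* Defs.v *)
From mathcomp Require Import all_boot.
From mathcomp Require Import classical_sets.

Set Implicit Arguments.
Unset Strict Implicit.
Unset Printing Implicit Defensive.

Local Open Scope classical_set_scope.

(* Sequences are indexed from 0: [a n] is the term a_(n+1), and [mu i] is the
   row mu_(i+1).  Positive integers are the elements n of nat with 0 < n. *)

Definition positive_integers : set nat := [set n | 0 < n].

Definition quasi_permutation (a : nat -> nat) : Prop :=
  (forall n, 0 < a n) /\ (forall m n, m <> n -> a m <> a n).

(* Only nonempty partial sums: 0 is not one of them. *)
Definition partial_sums (a : nat -> nat) : set nat :=
  range (fun n => \sum_(k < n.+1) a k).

Definition quasi_barrycade (mu : nat -> nat -> nat) : Prop :=
  (forall i, quasi_permutation (mu i)) /\
  (forall i j, i <> j -> partial_sums (mu i) `&` partial_sums (mu j) = set0).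

Definition break_free (mu : nat -> nat -> nat) : Prop :=
  \bigcup_i partial_sums (mu i) = positive_integers.

(* Main.v *)
(** The dyadic block [[2^k, 2^(k+1))] is filled from the right by the numbers
    [2^(k+1) - j] with [1 <= j <= 2^k], and [2^(k+1) - j] is given to row [j].
    A row that enters at block [k] starts with a term smaller than [2^(k+1)],
    and its later terms are the gaps [2^(k+1), 2^(k+2), ...] between
    consecutive blocks, so every row is strictly increasing. *)
Require Import Defs.
From mathcomp Require Import all_boot.
From mathcomp Require Import classical_sets.
From mathcomp Require Import zify.

(** Row [i] is j = i + 1 of the overview; [up_log 2 i.+1] is the first block with at least j
    elements, where the row enters. *)
Definition dyadic_row (i n : nat) : nat :=
  if n is m.+1 then 2 ^ (up_log 2 i.+1 + m.+1) else 2 ^ (up_log 2 i.+1).+1 - i.+1.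

(** Keeps the natural-number subtractions of [i.+1] from truncating. *)
Lemma leq_exp2_up_log (i n : nat) : i.+1 <= 2 ^ (up_log 2 i.+1 + n).
Proof. by rewrite expnD (leq_trans (up_logP i.+1 (ltnSn 1))) // leq_pmulr // expn_gt0. Qed.

Lemma dyadic_row_gt0 (i n : nat) : 0 < dyadic_row i n.
Proof.
case: n => [|n] /=; last by rewrite expn_gt0.
by have := leq_exp2_up_log i 0; rewrite addn0 expnS; lia.
Qed.

Lemma dyadic_row_increasing (i : nat) : {homo dyadic_row i : m n / m < n}.
Proof.
apply: homo_ltn; first exact: ltn_trans.
case=> [|n] /=; last by rewrite ltn_exp2l ?ltn_add2l.
by have := leq_exp2_up_log i 0; rewrite addn0 addn1 !expnS; lia.
Qed.

Lemma quasi_permutation_dyadic_row (i : nat) : quasi_permutation (dyadic_row i).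
Proof.
split=> [n|m n /eqP]; first exact: dyadic_row_gt0.
by rewrite neq_ltn => /orP[] /(dyadic_row_increasing i) /=; lia.
Qed.

(** Each new gap carries the sum into the next block, at the same distance below the next power of
    2. *)
Lemma sum_dyadic_row (i n : nat) :
  \sum_(k < n.+1) dyadic_row i k = 2 ^ (up_log 2 i.+1 + n).+1 - i.+1.
Proof.
elim: n => [|n IHn]; first by rewrite big_ord1 addn0.
have := leq_exp2_up_log i n.+1.
by rewrite big_ord_recr /= IHn !addnS [in RHS]expnS; lia.
Qed.

Lemma trunc_log_sum_dyadic_row (i n : nat) :
  trunc_log 2 (\sum_(k < n.+1) dyadic_row i k) = up_log 2 i.+1 + n.
Proof.
rewrite sum_dyadic_row; apply: trunc_log_eq => //.
by have := leq_exp2_up_log i n; rewrite expnS; lia.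
Qed.

(** [trunc_log] recovers the block from x, and the distance from x up to the next power of 2 then
    gives the row. *)
Lemma partial_sums_dyadic_row_inj (i j x : nat) :
  partial_sums (dyadic_row i) x -> partial_sums (dyadic_row j) x -> i = j.
Proof.
move=> [m _ <-] [n _ eq_sum].
have := congr1 (trunc_log 2) eq_sum; rewrite !trunc_log_sum_dyadic_row => eq_log.
move: eq_sum; rewrite !sum_dyadic_row -eq_log.
have := leq_exp2_up_log i m; have := leq_exp2_up_log j n.
by rewrite eq_log expnS; lia.
Qed.

Lemma partial_sums_dyadic_row_cover (x : nat) :
  0 < x -> exists i, partial_sums (dyadic_row i) x.
Proof.
move=> x_gt0; set k := trunc_log 2 x.
have /andP[le_x lt_x] : 2 ^ k <= x < 2 ^ k.+1 by exact: trunc_log_bounds.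
(* Here j = [2 ^ k.+1 - x], lowered by 1 as rows count from 0; the position is the number of blocks
   since row j entered. *)
exists (2 ^ k.+1 - x).-1, (k - up_log 2 (2 ^ k.+1 - x).-1.+1) => //.
have le_k : up_log 2 (2 ^ k.+1 - x).-1.+1 <= k.
  by apply: up_log_min => //; move: lt_x; rewrite expnS; lia.
by rewrite sum_dyadic_row subnKC //; lia.
Qed.

Theorem theorem2 :
  exists mu : nat -> nat -> nat, quasi_barrycade mu /\ break_free mu.
Proof.
exists dyadic_row; split; first split.
- exact: quasi_permutation_dyadic_row.
- move=> i j neq_ij; apply/seteqP; split=> // x [xi xj].
  by case: neq_ij; apply: partial_sums_dyadic_row_inj xi xj.
- apply/seteqP; split=> [x [i _ [n _ <-]]|x x_gt0].
    by rewrite /positive_integers /= big_ord_recl ltn_addr // dyadic_row_gt0.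
  by have [i xi] := partial_sums_dyadic_row_cover x x_gt0; exists i.
Qed.
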